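(* Let $d\ge0$, let $A=\mathrm{Aut}(X_{14})\cong F_{20}$, and let $W_d=S_6\wr S_d$ act on $V(H(d,6))=\{1,\ldots,6\}^d$ in product action, so that $W_0$ is the group of order $1$ acting on the one-point set and $\Gamma_0=X_{14}$, where $\Gamma_d=X_{14}\,\square\,H(d,6)$. Then $$\mathrm{Aut}(\Gamma_d)=A\times W_d,$$ and the regular subgroups of $\mathrm{Aut}(\Gamma_d)$ are precisely the groups $$R_\varphi=\{(a,c)\in A\times N_{W_d}(H): cH=\varphi(a)\},$$ where $H$ is a regular subgroup of $W_d$ and $\varphi:A\to N_{W_d}(H)/H$ is a homomorphism. Moreover $R_\varphi\cong H\rtimes_\psi A$, where $\psi:A\to\mathrm{Aut}(H)$ is the composite of $\varphi$ with the embedding of $N_{W_d}(H)/H$ into $\mathrm{Aut}(H)$ given by conjugation. Every $R_\varphi$ has a quotient isomorphic to $F_{20}$; in particular, $\Gamma_d$ is not a Cayley graph of an abelian group.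
   Context: $F_{20}=\langle a,b\mid a^5=b^4=1,\ bab^{-1}=a^2\rangle$ is the Frobenius group of order $20$. Writing $(i,j)$ for $a^ib^j$, let $$S=\{(0,1),(0,2),(0,3),(1,0),(1,1),(1,2),(1,3),(2,0),(2,3),(3,0),(3,1),(3,3),(4,0),(4,1)\},$$ which is inverse-closed, and let $X_{14}=\mathrm{Cay}(F_{20},S)$, where $\mathrm{Cay}(G,S)$ is the graph with vertex set $G$ and $g\sim h$ if and only if $hg^{-1}\in S$. The group $\mathrm{Aut}(X_{14})$ consists exactly of the right translations $x\mapsto xg$, $g\in F_{20}$. $H(d,6)=K_6^{\square d}$ is the Hamming graph, with vertex set $\{1,\ldots,6\}^d$, two vertices adjacent when they differ in exactly one coordinate; $H(0,6)$ is the one-vertex graph. $\square$ denotes the Cartesian product of graphs. In the product action of $S_6\wr S_d=S_6^d\rtimes S_d$ on $\{1,\ldots,6\}^d$, $S_6^d$ acts coordinatewise and $S_d$ permutes coordinates. $A\times W_d$ acts on $V(\Gamma_d)=V(X_{14})\times\{1,\ldots,6\}^d$ coordinatewise. A permutation group is regular if it is transitive with trivial point stabilizers. A graph is a Cayley graph of a group $K$ if it is isomorphic to $\mathrm{Cay}(K,S')$ for some inverse-closed $S'\subseteq K\setminus\{1_K\}$. The embedding of $N/H$ into $\mathrm{Aut}(H)$ given by conjugation, where $N=N_{W_d}(H)$, is the following: fix a base point $\omega_0\in\{1,\ldots,6\}^d$; the stabilizer $N_{\omega_0}$ is a complement to $H$ in $N$ and so maps isomorphically onto $N/H$; the inverse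 isomorphism $N/H\to N_{\omega_0}$ is followed by the (faithful) conjugation action of $N_{\omega_0}$ on $H$. *)

(* Defs.v *)
From HB Require Import structures.
From mathcomp Require Import all_boot all_order all_algebra all_fingroup.
From mathcomp Require Import all_solvable.

Set Implicit Arguments.
Unset Strict Implicit.
Unset Printing Implicit Defensive.

Import GroupScope.

Definition autgraph_set (T : finType) (e : rel T) : {set {perm T}} :=
  [set s : {perm T} | [forall x, forall y, e (s x) (s y) == e x y]].

Lemma autgraphP (T : finType) (e : rel T) (s : {perm T}) :
  reflect (forall x y, e (s x) (s y) = e x y) (s \in autgraph_set e).
Proof.
rewrite inE; apply: (iffP forallP) => [h x y | h x].
  by have /forallP/(_ y)/eqP := h x.
by apply/forallP => y; apply/eqP/h.
Qed.

Lemma autgraph_group_set (T : finType) (e : rel T) :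
  group_set (autgraph_set e).
Proof.
apply/group_setP; split=> [|s t /autgraphP es /autgraphP et]; apply/autgraphP.
  by move=> x y; rewrite !perm1.
by move=> x y; rewrite !permM et es.
Qed.

Definition autgraph (T : finType) (e : rel T) : {group {perm T}} :=
  Group (autgraph_group_set e).

Definition graph_iso (T1 T2 : finType) (e1 : rel T1) (e2 : rel T2) : Prop :=
  exists2 f : T1 -> T2, bijective f & forall x y, e2 (f x) (f y) = e1 x y.

Definition cartesian (T1 T2 : finType) (e1 : rel T1) (e2 : rel T2) :
    rel (T1 * T2)%type :=
  fun u v => (u.1 == v.1) && e2 u.2 v.2 || e1 u.1 v.1 && (u.2 == v.2).

Definition Cay (K : finGroupType) (S : {set K}) : rel K :=
  fun g h => h * g^-1 \in S.

Definition is_Cayley_graph_of (K : finGroupType) (T : finType) (e : rel T) :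
    Prop :=
  exists S : {set K},
    [/\ 1 \notin S, {in S, forall x, x^-1 \in S} & graph_iso e (Cay S)].

(* The pair (i, j) stands for a^i b^j; since b^j a^k b^-j = a^(2^j k), we get
   (i, j)(k, l) = (i + 2^j k, j + l).  The presentation is proved below. *)
Definition F20 : Type := ('Z_5 * 'Z_4)%type.
HB.instance Definition _ := Finite.on F20.

Section F20.
Import GRing.Theory.
Local Open Scope ring_scope.

Definition F20_mul (g h : F20) : F20 :=
  (g.1 + 2%:R ^+ (val g.2) * h.1, g.2 + h.2).
Definition F20_one : F20 := (0, 0).
Definition F20_inv (g : F20) : F20 :=
  (- (2%:R ^+ (val (- g.2)) * g.1), - g.2).

Lemma F20_pow2D (j l : 'Z_4) :
  2%:R ^+ (val (j + l)%R) = 2%:R ^+ (val j) * 2%:R ^+ (val l) :> 'Z_5.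
Proof.
by move: j l; do 2![case; do 4?[case=> //] => ?]; apply: val_inj.
Qed.

Lemma F20_mulA : associative F20_mul.
Proof.
move=> [i j] [k l] [m n]; rewrite /F20_mul /=.
by rewrite F20_pow2D mulrDr !addrA mulrA.
Qed.

Lemma F20_mul1 : left_id F20_one F20_mul.
Proof. by case=> i j; rewrite /F20_mul /= expr0 mul1r !add0r. Qed.

Lemma F20_mulV : left_inverse F20_one F20_inv F20_mul.
Proof. by case=> i j; rewrite /F20_mul /F20_inv /= !addNr. Qed.

End F20.

HB.instance Definition _ :=
  Finite_isGroup.Build F20 F20_mulA F20_mul1 F20_mulV.

Definition F20_a : F20 := (1, 0)%R.
Definition F20_b : F20 := (0, 1)%R.

Lemma F20_mulE (g h : F20) : g * h = F20_mul g h. Proof. by []. Qed.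

Lemma F20E (i : 'Z_5) (j : 'Z_4) : (i, j) = F20_a ^+ i * F20_b ^+ j :> F20.
Proof.
by apply/eqP; case: i j => [[|[|[|[|[|//]]]]] ?] [[|[|[|[|//]]]] ?].
Qed.

Lemma card_F20 : #|[set: F20]| = 20.
Proof. by rewrite cardsT card_prod !card_ord. Qed.

Lemma F20_rel : [/\ F20_a ^+ 5 = 1, F20_b ^+ 4 = 1
  & F20_b * F20_a * F20_b^-1 = F20_a ^+ 2].
Proof. by split; apply/eqP. Qed.

Lemma F20_presentation : [set: F20] \isog
  Grp (a : b : a ^+ 5, b ^+ 4, b * a * b^-1 = a ^+ 2).
Proof.
apply: intro_isoGrp => [|rT H].
  apply/existsP; exists (F20_a, F20_b); rewrite /= !xpair_eqE /=.
  apply/andP; split=> //; rewrite eqEsubset subsetT /=.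
  apply/subsetP=> -[i j] _; rewrite F20E.
  by rewrite groupM // groupX // mem_gen // inE cycle_id ?orbT.
case/existsP=> -[x y] /=; rewrite !xpair_eqE /=.
case/and4P=> /eqP defH /eqP x5 /eqP y4 /eqP yx.
have xX (k : nat) : x ^+ (k %% 5) = x ^+ k by rewrite expg_mod.
have yX (k : nat) : y ^+ (k %% 4) = y ^+ k by rewrite expg_mod.
have yxX k l : y ^+ l * x ^+ k = x ^+ (2 ^ l * k) * y ^+ l.
  elim: l k => [|l IHl] k; first by rewrite mul1n mul1g mulg1.
  have yxk m : y * x ^+ m = x ^+ (2 * m) * y.
    apply: (mulIg y^-1); rewrite mulgK expgM -yx.
    by elim: m => [|m IHm]; rewrite ?mulg1 ?mulgV // !expgS -IHm !mulgA mulgKV.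
  by rewrite expgS -mulgA IHl mulgA yxk -!mulgA expnS mulnA.
pose f (g : F20) := x ^+ g.1 * y ^+ g.2.
have xZ (n : nat) : x ^+ (n%:R%R : 'Z_5) = x ^+ n by rewrite val_Zp_nat.
have fM : {in [set: F20] &, {morph f : g h / g * h}}.
  move=> [i j] [k l] _ _; rewrite /f F20_mulE /F20_mul /= yX expgD.
  transitivity (x ^+ ((i + 2 ^ j * k)%:R%R : 'Z_5) * (y ^+ j * y ^+ l)).
    by rewrite GRing.natrD GRing.natrM GRing.natrX !natr_Zp.
  rewrite xZ expgD -!mulgA; congr (_ * _).
  by rewrite !mulgA yxX.
apply/homgP; exists (Morphism fM); apply/eqP.
rewrite eqEsubset; apply/andP; split.
  apply/subsetP=> _ /morphimP[[i j] _ _ ->]; rewrite -defH /= /f /=.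
  by rewrite groupM // groupX // mem_gen // inE cycle_id ?orbT.
rewrite -defH join_subG !cycle_subG; apply/andP; split.
  have -> : x = Morphism fM F20_a by rewrite /= /f /= mulg1.
  by rewrite mem_morphim ?inE.
have -> : y = Morphism fM F20_b by rewrite /= /f /= mul1g.
by rewrite mem_morphim ?inE.
Qed.

(* Elements of the list are pairs (i, j), read as a^i b^j by F20E. *)
Definition S14 : {set F20} :=
  [set g : F20 | g \in [:: (0, 1); (0, 2); (0, 3);
                           (1, 0); (1, 1); (1, 2); (1, 3);
                           (2, 0); (2, 3);
                           (3, 0); (3, 1); (3, 3);
                           (4, 0); (4, 1)]%R].

Lemma S14_inv : {in S14, forall g, g^-1 \in S14}.
Proof.
by apply/forall_inP; apply/forallP=> -[[[|[|[|[|[|//]]]]] ?] [[|[|[|[|//]]]] ?]];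
  rewrite !inE.
Qed.

Lemma S14_not1 : 1 \notin S14. Proof. by rewrite inE. Qed.

Definition X14 : rel F20 := Cay S14.

Definition hamming (d q : nat) : rel {ffun 'I_d -> 'I_q} :=
  fun x y => #|[set i | x i != y i]| == 1%N.
Arguments hamming : clear implicits.

Section Wreath.
Variables d q : nat.
Local Notation V := {ffun 'I_d -> 'I_q}.
Local Notation base := {dffun forall _ : 'I_d, {perm 'I_q}}.

Definition coordwise_fun (s : base) (x : V) : V := [ffun i => s i (x i)].
Lemma coordwise_inj s : injective (coordwise_fun s).
Proof.
by move=> x y /ffunP exy; apply/ffunP=> i; have:= exy i; rewrite !ffunE => /perm_inj.
Qed.
Definition coordwise (s : base) : {perm V} := perm (@coordwise_inj s).

Lemma coordwiseE s x i : coordwise s x i = s i (x i).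
Proof. by rewrite permE ffunE. Qed.

Lemma coordwiseM : {in [set: base] &, {morph coordwise : s t / s * t}}.
Proof.
move=> s t _ _; apply/permP=> x; apply/ffunP=> i.
by rewrite permM !coordwiseE ffunE permM.
Qed.
Canonical coordwise_morphism := Morphism coordwiseM.

(* p^-1 makes this a morphism for the composition (p * p') i = p' (p i). *)
Definition permcoord_fun (p : 'S_d) (x : V) : V := [ffun i => x (p^-1 i)].
Lemma permcoord_inj p : injective (permcoord_fun p).
Proof.
move=> x y /ffunP exy; apply/ffunP=> i.
by have:= exy (p i); rewrite !ffunE permK.
Qed.
Definition permcoord (p : 'S_d) : {perm V} := perm (@permcoord_inj p).

Lemma permcoordE p x i : permcoord p x i = x (p^-1 i).
Proof. by rewrite permE ffunE. Qed.

Lemma permcoordM : {in [set: 'S_d] &, {morph permcoord : p t / p * t}}.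
Proof.
move=> p t _ _; apply/permP=> x; apply/ffunP=> i.
by rewrite permM !permcoordE invMg permM.
Qed.
Canonical permcoord_morphism := Morphism permcoordM.

Definition wreath : {group {perm V}} :=
  (coordwise @* [set: base] <*> permcoord @* [set: 'S_d])%G.

Lemma injm_coordwise : 'injm coordwise.
Proof.
apply/injmP=> s t _ _ /permP est; apply/ffunP=> i; apply/permP=> z.
by have /ffunP/(_ i) := est [ffun=> z]; rewrite !coordwiseE !ffunE.
Qed.

Lemma injm_permcoord : (1 < q)%N -> 'injm permcoord.
Proof.
move=> q_gt1; apply/injmP=> s t _ _ /permP est; apply: invg_inj.
apply/permP=> i.
pose o0 := Ordinal (ltnW q_gt1); pose o1 := Ordinal q_gt1.
have /ffunP/(_ i) := est [ffun j => if j == s^-1 i then o1 else o0].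
by rewrite !permcoordE !ffunE eqxx; case: eqP => // ->.
Qed.

Lemma wreath_sdprod : (1 < q)%N ->
  coordwise @* [set: base] ><| permcoord @* [set: 'S_d] = wreath.
Proof.
move=> q_gt1; apply: sdprodEY.
  apply/subsetP=> _ /morphimP[p _ _ ->]; rewrite inE.
  apply/subsetP=> _ /imsetP[_ /morphimP[s _ _ ->] ->].
  have -> : coordwise s ^ permcoord p = coordwise [ffun i => s (p^-1 i)].
    apply/permP=> x; apply/ffunP=> i; rewrite conjgE !permM.
    rewrite -(morphV permcoord_morphism) ?inE //= coordwiseE ffunE permcoordE.
    by rewrite coordwiseE permcoordE invgK permKV.
  by rewrite mem_morphim ?inE.
apply/trivgP/subsetP=> _ /setIP[/morphimP[s _ _ ->] /morphimP[p _ _ /= esp]].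
rewrite inE; apply/eqP/permP=> x; rewrite perm1.
apply/ffunP=> i; move/permP: esp => esp.
have sx0 z : s i z = z.
  by have /ffunP/(_ i) := esp [ffun=> z]; rewrite coordwiseE permcoordE !ffunE.
by rewrite coordwiseE sx0.
Qed.

Lemma card_wreath : (1 < q)%N -> #|wreath| = (q`! ^ d * d`!)%N.
Proof.
move=> q_gt1; rewrite -(sdprod_card (wreath_sdprod q_gt1)).
rewrite !card_injm ?injm_coordwise ?injm_permcoord //.
rewrite !cardsT card_Sn card_dep_ffun foldrE big_map big_enum /=.
by rewrite prod_nat_const card_Sn card_ord.
Qed.

End Wreath.

Definition W (d : nat) : {group {perm {ffun 'I_d -> 'I_6}}} := wreath d 6.

Definition Gamma (d : nat) : rel (F20 * {ffun 'I_d -> 'I_6})%type :=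
  cartesian X14 (hamming d 6).
Arguments Gamma : clear implicits.

Lemma card_W0 : #|W 0| = 1%N. Proof. by rewrite card_wreath. Qed.

Lemma Gamma0_iso : graph_iso (Gamma 0) X14.
Proof.
have eqV (x y : {ffun 'I_0 -> 'I_6}) : x = y by apply/ffunP=> -[].
exists fst; first by exists (fun g => (g, [ffun=> ord0])) => // -[g x] /=; congr pair.
move=> [g x] [h y]; rewrite /Gamma /cartesian /= (eqV x y) eqxx andbT /hamming.
rewrite (_ : [set i | _] = set0) ?cards0 ?andbF //.
by apply/setP=> -[].
Qed.

Section PairPerm.
Variables T1 T2 : finType.
Local Notation perm2 := ({perm T1} * {perm T2})%type.

Definition pair_perm_fun (st : perm2) (u : T1 * T2) := (st.1 u.1, st.2 u.2).
Lemma pair_perm_inj st : injective (pair_perm_fun st).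
Proof. by move=> [x y] [z t] [/perm_inj -> /perm_inj ->]. Qed.
Definition pair_perm (st : perm2) : {perm T1 * T2} := perm (@pair_perm_inj st).

Lemma pair_permM : {in [set: perm2] &, {morph pair_perm : s t / s * t}}.
Proof. by move=> s t _ _; apply/permP=> u; rewrite permM !permE /= /pair_perm_fun !permM. Qed.
Canonical pair_perm_morphism := Morphism pair_permM.
End PairPerm.
Arguments pair_perm {T1 T2}.

Definition regular_perm_group (T : finType) (G : {set {perm T}}) : bool :=
  [transitive G, on [set: T] | 'P] && [forall x, 'C_G[x | 'P] == 1].

(* For a regular subgroup H of G, the stabilizer N_w of a point w in
   N = 'N_G(H) is a complement to H in N; [norm_embed] is the morphism
   N / H -> Aut H obtained by inverting N_w -> N / H and letting N_w act on H
   by conjugation.  Permutations compose from left to right and h ^ n is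
   n^-1 * h * n, so that conjugation is a morphism N_w -> Aut H. *)
Section NormEmbedding.
Variables (T : finType) (G H : {group {perm T}}).
Hypotheses (sHG : H \subset G) (regH : regular_perm_group H).
Variable w : T.

Local Notation N := 'N_G(H).
Local Notation Nw := 'C_(N)[w | 'P].

Lemma norm_stab_sdprod : H ><| Nw = N.
Proof.
have [trH /forallP/(_ w)/eqP stH] := andP regH.
have sHN : H \subset N by rewrite subsetI sHG normG.
have nHNw : Nw \subset 'N(H).
  exact: subset_trans (subsetIl _ _) (subsetIr _ _).
have trN : [transitive N, on [set: T] | 'P].
  rewrite (atrans_supgroup _ trH) //.
  by apply/subsetP=> n Nn; rewrite !inE /=; apply/subsetP=> v; rewrite !inE.
rewrite sdprodE //.
  rewrite -(normC nHNw).
  exact: (elimT (subgroup_transitiveP (in_setT w) sHN trN) trH).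
by rewrite setIA (setIidPl sHN).
Qed.

Lemma norm_stab_sub : Nw \subset 'N(H).
Proof. exact: subset_trans (subsetIl _ _) (subsetIr _ _). Qed.

Definition stab_coset : perm_type T -> coset_of H :=
  restrm norm_stab_sub (coset H).
Canonical stab_coset_morphism := [morphism of stab_coset].

Lemma injm_stab_coset : 'injm stab_coset.
Proof.
have [nH /isomP[inj _]] := sdprod_isom norm_stab_sdprod.
by move: inj; rewrite !ker_restrm.
Qed.

Lemma im_stab_coset : stab_coset @* Nw = N / H.
Proof.
have [nH /isomP[_ <-]] := sdprod_isom norm_stab_sdprod.
by rewrite !morphim_restrm.
Qed.

Definition stab_lift (x : coset_of H) : {perm T} := invm injm_stab_coset x.
Definition norm_embed (x : coset_of H) : {perm {perm T}} :=
  conj_aut H (stab_lift x).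

Lemma norm_embedM : {in N / H &, {morph norm_embed : x y / x * y}}.
Proof.
rewrite -im_stab_coset => x y Nx Ny; rewrite /norm_embed /stab_lift morphM //.
have lift_norm z : z \in stab_coset @* Nw -> invm injm_stab_coset z \in 'N(H).
  by case/morphimP=> n _ Nn ->; rewrite invmE // (subsetP norm_stab_sub).
by rewrite morphM ?lift_norm.
Qed.
Canonical norm_embed_morphism := Morphism norm_embedM.

Lemma norm_embed_Aut x : norm_embed x \in Aut H.
Proof. exact: Aut_aut. Qed.

Lemma norm_embed_coset n h :
  n \in Nw -> h \in H -> norm_embed (coset H n) h = h ^ n.
Proof.
move=> Nn Hh; rewrite /norm_embed /stab_lift.
rewrite (_ : coset H n = stab_coset n) // invmE //.
by rewrite norm_conj_autE ?(subsetP norm_stab_sub).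
Qed.

Lemma injm_norm_embed : 'injm norm_embed.
Proof.
have [trH _] := andP regH.
apply/subsetP=> x; rewrite !inE => /andP[Nx /eqP ex1].
have /morphimP[n _ Nn defx] : x \in stab_coset @* Nw by rewrite im_stab_coset.
have en : norm_embed (coset H n) = 1 by rewrite -ex1 defx.
suff n1 : n = 1 by rewrite defx /= n1 morph1.
apply/permP=> v; rewrite perm1.
have [h Hh ->] := atransP2 trH (in_setT w) (in_setT v).
have nw : n w = w by move: Nn => /setIP[_ /astab1P].
have : h ^ n = h.
  by rewrite -(norm_embed_coset Nn Hh) -[in RHS](perm1 h) -en.
move/conjg_fixP/commgP => cnh.
by rewrite /= apermE -permM cnh permM nw.
Qed.

End NormEmbedding.

Section ExtSemidirect.
Variables (aT rT : finGroupType) (A : {group aT}) (H : {group rT}).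
Variable psi : {morphism A >-> {perm rT}}.
Hypothesis psi_Aut : psi @* A \subset Aut H.

Lemma aut_act_dom : A \subset psi @*^-1 (Aut H).
Proof. by rewrite -sub_morphim_pre. Qed.

Definition aut_act : groupAction A H := (([Aut H] \o psi) \ aut_act_dom)%gact.

Lemma aut_actE a h : a \in A -> aut_act h a = psi a h.
Proof. by []. Qed.

Definition ext_sdprod : finGroupType := sdprod_by aut_act.
End ExtSemidirect.

Section RegularSubgroups.
Variables (T1 T2 : finType).
Variables (A : {group {perm T1}}) (G H : {group {perm T2}}).
Variable phi : {morphism A >-> coset_of H}.

Definition R_pairs_set : {set {perm T1} * {perm T2}} :=
  [set ac in setX A 'N_G(H) | coset H ac.2 == phi ac.1].

Lemma mem_R_pairs a c : ((a, c) \in R_pairs_set) =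
  [&& a \in A, c \in 'N_G(H) & coset H c == phi a].
Proof. by rewrite inE in_setX -andbA. Qed.

Lemma R_pairs_group_set : group_set R_pairs_set.
Proof.
apply/group_setP; split.
  by rewrite inE in_setX !group1 /=; apply/eqP; rewrite [RHS]morph1 [LHS]morph1.
move=> [a c] [b e]; rewrite !mem_R_pairs.
case/and3P=> Aa Nc /eqP ec /and3P[Ab Ne /eqP ee].
have [/setIP[_ nc] /setIP[_ ne]] := (Nc, Ne).
by rewrite !groupM //= coset_morphM // morphM // ec ee eqxx.
Qed.
Definition R_pairs := Group R_pairs_group_set.

Definition R_phi : {group {perm T1 * T2}} :=
  (pair_perm @* R_pairs)%G.

Hypotheses (sHG : H \subset G) (regH : regular_perm_group H).
Hypothesis im_phi : phi @* A \subset 'N_G(H) / H.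
Variable w : T2.

Definition conj_psi (a : {perm T1}) : {perm {perm T2}} :=
  norm_embed sHG regH w (phi a).

Lemma conj_psiM : {in A &, {morph conj_psi : a b / a * b}}.
Proof.
move=> a b Aa Ab; rewrite /conj_psi morphM // morphM //.
  by rewrite (subsetP im_phi) ?mem_morphim.
by rewrite (subsetP im_phi) ?mem_morphim.
Qed.
Canonical conj_psi_morphism := Morphism conj_psiM.

Lemma conj_psi_Aut : conj_psi @* A \subset Aut H.
Proof. by apply/subsetP=> _ /morphimP[a _ _ ->]; apply: norm_embed_Aut. Qed.

Definition H_sdprod_A : finGroupType := ext_sdprod conj_psi_Aut.

End RegularSubgroups.

(* Main.v *)
(* In X14 any two vertices have at least 8 common neighbours, while in
   Gamma d two vertices with distinct H(d,6)-coordinates have at most 7.  An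
   automorphism of Gamma d therefore permutes the copies of X14, and following
   the edges joining distinct copies (H(d,6) is connected) shows that it is a
   product of automorphisms of the two factors.

   An automorphism of H(d,6) permutes the lines through a point x0, and so
   agrees on them with an element of the wreath product; an automorphism
   fixing every line through x0 pointwise is trivial, because a vertex at
   distance at least 2 from x0 is determined by its neighbours closer to x0.

   If R is a regular subgroup of A x G with A regular, then R projects onto A
   and the kernel 1 x H of this projection is regular on the second factor, so
   R is the graph of a homomorphism A -> N_G(H) / H up to H. *)
Require Import Defs.
From mathcomp Require Import all_boot all_algebra all_fingroup.
Import GroupScope.

Set Implicit Arguments.
Unset Strict Implicit.
Unset Printing Implicit Defensive.

(** * Regularity in terms of points, and common neighbours in a graph *)

Lemma regular_permP (T : finType) (x0 : T) (G : {group {perm T}}) :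
  reflect ((forall x y, exists2 g, g \in G & g x = y) /\
           (forall g x, g \in G -> g x = x -> g = 1))
          (regular_perm_group G).
Proof.
apply: (iffP andP) => [[trG /forallP stG] | [trG stG]]; split.
- move=> x y; have [g Gg ->] := atransP2 trG (in_setT x) (in_setT y).
  by exists g.
- move=> g x Gg gx; apply/set1gP; rewrite -(eqP (stG x)) inE Gg.
  exact/astab1P.
- apply/imsetP; exists x0 => //; apply/setP=> y; rewrite inE.
  by apply/esym/orbitP; have [g Gg <-] := trG x0 y; exists g.
- apply/forallP=> x; apply/eqP/trivgP/subsetP=> g /setIP[Gg /astab1P gx].
  exact/set1gP/(stG g x).
Qed.

(** For [u = v] this counts the neighbours of [u], so a bound over all pairs includes the
    diagonal. *)
Definition codeg (T : finType) (e : rel T) (u v : T) : nat :=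
  #|[set w | e u w && e v w]|.

Lemma codeg_aut (T : finType) (e : rel T) (s : {perm T}) (u v : T) :
  s \in autgraph e -> codeg e (s u) (s v) = codeg e u v.
Proof.
move=> /autgraphP es; rewrite /codeg -[RHS](card_imset _ (@perm_inj _ s)).
apply: eq_card => w; have [w' ->] : exists w', w = s w'.
  by exists (s^-1 w); rewrite permKV.
by rewrite mem_imset ?inE ?es //; apply: perm_inj.
Qed.


(** * Right translations as automorphisms of Cayley graphs *)

Definition right_translations (K : finGroupType) : {group {perm K}} :=
  (actperm 'R @* [set: K])%G.

Lemma right_translationsP (K : finGroupType) (s : {perm K}) :
  reflect (exists g, forall x, s x = x * g) (s \in right_translations K).
Proof.
apply: (iffP morphimP) => [[g _ _ ->] | [g sg]].
  by exists g => x; rewrite actpermE.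
by exists g; rewrite ?inE //; apply/permP=> x; rewrite actpermE sg.
Qed.

Lemma right_translations_isog (K : finGroupType) :
  [set: K] \isog right_translations K.
Proof.
apply: (sub_isog (f := actperm_morphism 'R)) => //.
by apply/injmP=> g h _ _ /permP/(_ 1); rewrite !actpermE /= !mul1g.
Qed.

Lemma right_translations_regular (K : finGroupType) :
  regular_perm_group (right_translations K).
Proof.
apply/(regular_permP (1 : K)); split=> [x y | s x /right_translationsP[g sg]].
  exists (actperm 'R (x^-1 * y)); first by rewrite mem_morphim ?inE.
  by rewrite actpermE /= mulKVg.
rewrite sg => /(canRL (mulKg x)); rewrite mulVg => g1.
by apply/permP=> y; rewrite sg g1 mulg1 perm1.
Qed.

Lemma right_translations_Cay (K : finGroupType) (S : {set K}) :
  right_translations K \subset autgraph (Cay S).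
Proof.
apply/subsetP=> s /right_translationsP[g sg]; apply/autgraphP=> x y.
by rewrite /Cay !sg invMg mulgA mulgK.
Qed.

(** Right translation by [h] is an automorphism carrying the right-hand pair to the left-hand one.
    Taking one vertex to be [1] leaves only 20 pairs to compute in X14. *)
Lemma codeg_Cay (K : finGroupType) (S : {set K}) (g h : K) :
  codeg (Cay S) g h = codeg (Cay S) (g * h^-1) 1.
Proof.
have Ah : actperm 'R h \in autgraph (Cay S).
  by rewrite (subsetP (right_translations_Cay S)) // mem_morphim ?inE.
have eh x : actperm 'R h x = x * h by rewrite actpermE.
by rewrite -[RHS](codeg_aut _ _ Ah) !eh mulgKV mul1g.
Qed.

(** Dividing [s] by the right translation by [s 1] gives an automorphism that fixes [1], which is
    trivial by hypothesis. *)
Lemma autgraph_Cay (K : finGroupType) (S : {set K}) :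
  (forall s, s \in autgraph (Cay S) -> s 1 = 1 -> s = 1) ->
  autgraph (Cay S) = right_translations K :> {set _}.
Proof.
move=> st1; apply/eqP; rewrite eqEsubset right_translations_Cay andbT.
apply/subsetP=> s As.
have Rt : actperm 'R (s 1) \in right_translations K.
  by rewrite mem_morphim ?inE.
suff /eqP : s * (actperm 'R (s 1))^-1 = 1 by rewrite -eq_mulgV1 => /eqP->.
apply: st1; first by rewrite groupM ?groupV // (subsetP (right_translations_Cay S)).
apply: (perm_inj (s := actperm 'R (s 1))).
by rewrite permM permKV actpermE /= mul1g.
Qed.

(** * The graph X14 *)

(** Lets injectivity on a list be settled by evaluating [uniq]. *)
Lemma uniq_map_inj (T1 T2 : eqType) (f : T1 -> T2) (s : seq T1) :
  uniq [seq f x | x <- s] -> {in s &, injective f}.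
Proof.
move=> fs x y sx sy fxy; rewrite -(nth_index x sx) -(nth_index x sy).
congr nth; apply/eqP; rewrite -(nth_uniq (f x) _ _ fs) ?size_map ?index_mem //.
by rewrite !(nth_map x) ?index_mem // !nth_index ?fxy.
Qed.

Definition F20_seq : seq F20 :=
  [seq (i, j) | i <- ([:: 0; 1; 2; 3; 4]%R : seq 'Z_5),
                j <- ([:: 0; 1; 2; 3]%R : seq 'Z_4)].

Lemma mem_F20_seq g : g \in F20_seq.
Proof. by case: g => [[[|[|[|[|[|//]]]]] ?] [[|[|[|[|//]]]] ?]]. Qed.

(* Unlike X14, which goes through a locked finset, X14c can be evaluated. *)
Definition X14c (g h : F20) : bool :=
  F20_mul h (F20_inv g) \in
    [:: (0, 1); (0, 2); (0, 3); (1, 0); (1, 1); (1, 2); (1, 3);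
        (2, 0); (2, 3); (3, 0); (3, 1); (3, 3); (4, 0); (4, 1)]%R.

Lemma X14E g h : X14 g h = X14c g h.
Proof. by rewrite /X14 /Cay inE. Qed.

Definition X14_codegc (g h : F20) : nat :=
  count (fun w => X14c g w && X14c h w) F20_seq.

Lemma X14_codegE g h : codeg X14 g h = X14_codegc g h.
Proof.
rewrite /codeg /X14_codegc -size_filter -(card_uniqP _); last first.
  by rewrite filter_uniq //; vm_compute.
apply: eq_card => w; rewrite inE mem_filter mem_F20_seq andbT.
by rewrite !X14E.
Qed.

(** After translation only 20 values remain to be evaluated. The threshold 7 is the bound [q.+1] of
    [hamming_codeg] at [q = 6]. *)
Lemma X14_codeg g h : 7 < codeg X14 g h.
Proof.
rewrite [codeg _ _ _]codeg_Cay [codeg _ _ _]X14_codegE.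
by move: (mem_F20_seq (g * h^-1)); apply/allP: (g * h^-1); vm_compute.
Qed.

(* Fixing 1 fixes (0, 2), then (4, 0) and (4, 2), and profiles with respect to
   these four vertices tell all vertices apart. *)
Definition X14_profile (L : seq F20) (v : F20) : seq (bool * bool * nat) :=
  [seq (v == u, X14c u v, X14_codegc u v) | u <- L].

(** An automorphism fixing [L] pointwise preserves profiles relative to [L], so it fixes a vertex
    whose profile no other vertex shares. *)
Lemma X14_fix (L : seq F20) (v : F20) (s : {perm F20}) :
  s \in autgraph X14 -> {in L, forall u, s u = u} ->
  all (fun w => (X14_profile L w == X14_profile L v) ==> (w == v)) F20_seq ->
  s v = v.
Proof.
move=> As sL /allP/(_ (s v) (mem_F20_seq _))/implyP-vP; apply/eqP/vP/eqP.
apply/eq_in_map => u /sL su; have /autgraphP es := As.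
by rewrite -{1 2 3}su (inj_eq perm_inj) -!X14E es -!X14_codegE codeg_aut.
Qed.

Lemma X14_stab1 (s : {perm F20}) : s \in autgraph X14 -> s 1 = 1 -> s = 1.
Proof.
move=> As s1.
have s02 : s (0, 2)%R = (0, 2)%R.
  apply: (X14_fix (L := [:: 1]) As); last by vm_compute.
  by move=> u /[!inE] /eqP->.
pose L2 : seq F20 := [:: (1 : F20); (0, 2)%R].
have fix02 : {in L2, forall u, s u = u}.
  by move=> u /[!inE] /pred2P[]->.
have s40 : s (4, 0)%R = (4, 0)%R by apply: (X14_fix As fix02); vm_compute.
have s42 : s (4, 2)%R = (4, 2)%R by apply: (X14_fix As fix02); vm_compute.
pose L4 : seq F20 := [:: (1 : F20); (0, 2)%R; (4, 0)%R; (4, 2)%R].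
have fix44 : {in L4, forall u, s u = u}.
  by move=> u /[!inE] /or4P[] /eqP->.
have profile_inj : {in F20_seq &, injective (X14_profile L4)}.
  by apply: uniq_map_inj; vm_compute.
apply/permP=> v; rewrite perm1; apply: (X14_fix As fix44).
apply/allP=> w _; apply/implyP=> /eqP/profile_inj wv; apply/eqP.
by apply: wv; apply: mem_F20_seq.
Qed.

Lemma autgraph_X14 : autgraph X14 = right_translations F20 :> {set _}.
Proof. exact: autgraph_Cay X14_stab1. Qed.

(** * Hamming graphs *)

Section Hamming.
Variables d q : nat.
Local Notation V := {ffun 'I_d -> 'I_q}.
Implicit Types (x y z : V) (i j : 'I_d) (a b : 'I_q).

(** With [a] varying, these are the points of the line through [x] in direction [i]. *)
Definition upd x i a : V := [ffun j => if j == i then a else x j].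

Lemma updE x i a j : upd x i a j = if j == i then a else x j.
Proof. by rewrite ffunE. Qed.

Lemma upd_id x i : upd x i (x i) = x.
Proof. by apply/ffunP=> j; rewrite updE; case: eqP => [->|]. Qed.

Lemma upd_upd x i a b : upd (upd x i a) i b = upd x i b.
Proof. by apply/ffunP=> j; rewrite !updE; case: eqP. Qed.

Lemma upd_inj x i : injective (upd x i).
Proof. by move=> a b /ffunP/(_ i); rewrite !updE eqxx. Qed.

Lemma hammingP x y :
  reflect (exists i, x i != y i /\ y = upd x i (y i)) (hamming d q x y).
Proof.
apply: (iffP cards1P) => [[i /setP xyi] | [i [xyi ->]]].
  exists i; split; first by have := xyi i; rewrite !inE eqxx.
  apply/ffunP=> j; rewrite updE; have := xyi j; rewrite !inE.
  by case: (j =P i) => [-> | _ /negbFE/eqP].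
exists i; apply/setP=> j; rewrite !inE updE.
by case: (j =P i) => [-> | _]; rewrite ?xyi ?eqxx.
Qed.

Lemma hamming_irrefl : irreflexive (hamming d q).
Proof. by move=> x; apply/hammingP=> -[i []]; rewrite eqxx. Qed.

Lemma hamming_upd x i a b : a != b -> hamming d q (upd x i a) (upd x i b).
Proof.
by move=> ab; apply/hammingP; exists i; rewrite !updE eqxx upd_upd.
Qed.

(** Correct one coordinate at a time, by induction on the number of coordinates where [x] and [y]
    differ. *)
Lemma hamming_connect x y : connect (hamming d q) x y.
Proof.
move: {2}#|_|.+1 (ltnSn #|[set i | x i != y i]|) => n.
elim: n x => // n IHn x xyn.
have [->|/eqP] := eqVneq x y; first exact: connect0.
case/ffunP/eqfunP/forallPn=> i xyi.
apply: connect_trans (connect1 _) (IHn (upd x i (y i)) _).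
  by rewrite -{1}(upd_id x i) hamming_upd.
apply: leq_trans (proper_card _) xyn; apply/properP; split.
  by apply/subsetP=> j; rewrite !inE updE; case: (j =P i) => [->|]; rewrite ?eqxx.
by exists i; rewrite !inE ?updE ?eqxx.
Qed.

Lemma hamming_diff x y i j :
  hamming d q x y -> x i != y i -> x j != y j -> i = j.
Proof.
case/cards1P=> k /setP xyk xyi xyj.
have /eqP-> : i == k by have := xyk i; rewrite !inE xyi.
by have /eqP : j == k by have := xyk j; rewrite !inE xyj.
Qed.

(** Let [k] be the coordinate where [z] differs from [upd x i a]. Then [k = i] leads to [x] and
    [k = j] to the opposite corner of the square; in every other situation [z] would differ from its
    neighbour [upd x j b] at both [i] and [j]. *)
Lemma hamming_square x z i j a b : i != j -> x i != a -> x j != b ->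
  hamming d q (upd x i a) z -> hamming d q (upd x j b) z ->
  z = x \/ z = upd (upd x i a) j b.
Proof.
move=> ij xia xjb /hammingP[k [_ zk]] xz.
have ji : (j == i) = false by rewrite eq_sym (negPf ij).
have diff k1 k2 : upd x j b k1 != z k1 -> upd x j b k2 != z k2 -> k1 = k2.
  exact: hamming_diff xz.
have [ki | ki] := eqVneq k i.
  left; rewrite zk ki upd_upd -[RHS](upd_id x i); congr upd.
  apply/eqP/contraT=> zi; case/eqP: (ij); apply: diff.
    by rewrite updE (negPf ij) eq_sym.
  by rewrite updE eqxx zk updE ki ji updE ji eq_sym.
have [kj | kj] := eqVneq k j.
  right; rewrite zk kj; congr upd.
  apply/eqP/contraT=> zj; case/eqP: (ij); apply: diff.
    by rewrite updE (negPf ij) zk updE kj (negPf ij) updE eqxx.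
  by rewrite updE eqxx eq_sym.
case/eqP: (ij); apply: diff.
  by rewrite updE (negPf ij) zk updE [i == k]eq_sym (negPf ki) updE eqxx.
by rewrite updE eqxx zk updE [j == k]eq_sym (negPf kj) updE ji eq_sym.
Qed.

Lemma autgraph_hamming_fix x0 (r : {perm V}) : r \in autgraph (hamming d q) ->
  (forall i a, r (upd x0 i a) = upd x0 i a) -> r x0 = x0 -> r = 1.
Proof.
move=> /autgraphP rH r1 r0; apply/permP=> x; rewrite perm1.
(* Induction on the distance from [x] to [x0]. *)
move: {2}#|_|.+1 (ltnSn #|[set i | x i != x0 i]|) => n.
elim: n x => // n IHn x xn.
(* Such a [y] is strictly closer to [x0] than [x], so the induction hypothesis applies. *)
have fix_upd y i : (forall j, x j = x0 j -> y j = x0 j) ->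
    x i != x0 i -> y i = x0 i -> r y = y.
  move=> xy xi yi; apply: IHn; apply: leq_trans (proper_card _) xn.
  apply/properP; split; last by exists i; rewrite !inE ?yi ?eqxx.
  by apply/subsetP=> j; rewrite !inE; apply: contraNneq => /xy->.
have [->//|/eqP/ffunP/eqfunP/forallPn[i xi]] := eqVneq x x0.
have [/existsP[j /andP[ji xj]] | /existsPn xD] :=
    boolP [exists j, (j != i) && (x j != x0 j)]; last first.
  suff -> : x = upd x0 i (x i) by [].
  apply/ffunP=> j; rewrite updE; case: eqVneq => [->//|ji].
  by have := xD j; rewrite ji negbK => /eqP.
have ri : r (upd x i (x0 i)) = upd x i (x0 i).
  apply: (fix_upd _ i) => // [k|]; rewrite updE ?eqxx //.
  by case: eqP => // ->.
have rj : r (upd x j (x0 j)) = upd x j (x0 j).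
  apply: (fix_upd _ j) => // [k|]; rewrite updE ?eqxx //.
  by case: eqP => // ->.
(* [r x] is a common neighbour of the two fixed vertices above, hence is [x] or this vertex. As this
   one is fixed too and differs from [x], injectivity excludes it. *)
have rij : r (upd (upd x i (x0 i)) j (x0 j)) = upd (upd x i (x0 i)) j (x0 j).
  apply: (fix_upd _ j) => // [k|]; rewrite updE ?eqxx // updE.
  by case: eqP => [->//|_]; case: eqP => // ->.
have nearx k : x k != x0 k -> hamming d q (upd x k (x0 k)) x.
  by move=> xk; rewrite -[x in hamming _ _ _ x](upd_id x k) hamming_upd // eq_sym.
have ij : i != j by rewrite eq_sym.
have [||//|rx] := hamming_square (z := r x) ij xi xj.
- by rewrite -ri rH nearx.
- by rewrite -rj rH nearx.
case/eqP: xi; move: rx; rewrite -rij => /perm_inj/ffunP/(_ i).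
by rewrite !updE eqxx eq_sym (negPf ji).
Qed.

Hypothesis q_gt1 : 1 < q.

Lemma ord_neq a : exists b, b != a.
Proof.
have [-> | ] := eqVneq a (Ordinal (ltnW q_gt1)); first by exists (Ordinal q_gt1).
by rewrite eq_sym; exists (Ordinal (ltnW q_gt1)).
Qed.

(* The neighbours of x in direction i form a clique with x, which can only be
   mapped into a clique through s x in a single direction. *)
Lemma autgraph_hamming_line (s : {perm V}) x i : s \in autgraph (hamming d q) ->
  exists j, forall a, s (upd x i a) = upd (s x) j (s (upd x i a) j).
Proof.
move=> /autgraphP sH; have [b bx] := ord_neq (x i).
have near_x a : a != x i -> hamming d q (s x) (s (upd x i a)).
  by rewrite eq_sym sH -{2}(upd_id x i); apply: hamming_upd.
have /hammingP[j [yj def_y]] := near_x b bx; exists j => a.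
have [-> | ax] := eqVneq a (x i); first by rewrite upd_id upd_id.
have [-> // | ab] := eqVneq a b.
have /hammingP[k [zk def_z]] := near_x a ax.
have [jk | jk] := eqVneq j k; first by rewrite jk.
have : hamming d q (s (upd x i a)) (s (upd x i b)) by rewrite sH hamming_upd.
move/hamming_diff => /(_ j k) jkP; case/eqP: (jk); apply: jkP.
  by rewrite def_z updE (negPf jk).
by rewrite def_y updE [k == j]eq_sym (negPf jk) eq_sym.
Qed.

Lemma wreath_sub_autgraph : wreath d q \subset autgraph (hamming d q).
Proof.
rewrite join_subG; apply/andP; split; apply/subsetP=> _ /morphimP[s _ _ ->].
  apply/autgraphP=> x y; congr (_ == _); apply: eq_card => i.
  by rewrite !inE !coordwiseE (inj_eq perm_inj).
apply/autgraphP=> x y; congr (_ == _).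
rewrite -[RHS](card_preimset _ (@perm_inj _ s^-1)); apply: eq_card => i.
by rewrite !inE !permcoordE.
Qed.

Theorem autgraph_hamming : autgraph (hamming d q) = wreath d q :> {set _}.
Proof.
apply/eqP; rewrite eqEsubset wreath_sub_autgraph andbT; apply/subsetP=> s sH.
have [x0 | noV] := pickP V; last first.
  by rewrite (_ : s = 1) ?group1 //; apply/permP=> x; have := noV x.
have [p pP] := fin_all_exists (fun i => autgraph_hamming_line x0 i sH).
(* If two directions at [x0] had the same image direction, neighbours of [x0] along them would have
   adjacent images, yet they differ in two coordinates. *)
have p_inj : injective p.
  move=> i j pij; apply/eqP/contraT=> ij.
  have [b bx] := ord_neq (x0 i); have [c cx] := ord_neq (x0 j).
  have : hamming d q (s (upd x0 i b)) (s (upd x0 j c)).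
    rewrite pP [s (upd x0 j c)]pP -pij hamming_upd //.
    (* Equal coordinates here would make the two images, hence the two points, equal, and force
       [b = x0 i]. *)
    apply: contraNneq bx => bc; move: (pP i b); rewrite bc pij -pP.
    move/perm_inj/ffunP/(_ i); rewrite !updE eqxx.
    by rewrite (negPf ij) => ->.
  have /autgraphP-> := sH; move/hamming_diff => /(_ i j) ijP.
  case/eqP: (ij); apply: ijP; rewrite !updE eqxx ?(negPf ij) //.
  by rewrite [j == i]eq_sym (negPf ij) eq_sym.
have t_inj i : injective (fun a => s (upd x0 i a) (p i)).
  move=> a b /= tab; apply: (@upd_inj x0 i); apply: (@perm_inj _ s).
  by rewrite pP tab -pP.
pose t : {dffun forall _ : 'I_d, {perm 'I_q}} := [ffun i => perm (@t_inj i)].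
(* Acting by [t i] on coordinate [i] and then moving it to [p i] reproduces [s] on all lines through
   [x0]. *)
pose w := coordwise t * permcoord q (perm p_inj).
have Ww : w \in wreath d q.
  by rewrite groupM ?mem_gen // inE mem_morphim ?inE ?orbT.
have wE x i : w x (p i) = s (upd x0 i (x i)) (p i).
  rewrite permM permcoordE -[p i](permE p_inj) permK coordwiseE ffunE permE.
  by rewrite permE.
have pK j : exists i, j = p i.
  by exists ((perm p_inj)^-1 j); rewrite -[RHS](permE p_inj) permKV.
have w0 : w x0 = s x0.
  by apply/ffunP=> j; have [i ->] := pK j; rewrite wE upd_id.
have wu i a : w (upd x0 i a) = s (upd x0 i a).
  apply/ffunP=> j; have [k ->] := pK j; rewrite wE updE.
  have [-> // | ki] := eqVneq k i.
  by rewrite upd_id (pP i) updE (inj_eq p_inj) (negPf ki).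
suff sw : s * w^-1 = 1 by rewrite -[s](mulgKV w) sw mul1g.
apply: (autgraph_hamming_fix (x0 := x0)).
- by rewrite groupM ?groupV // (subsetP wreath_sub_autgraph).
- by move=> i a; rewrite permM -wu permK.
- by rewrite permM -w0 permK.
Qed.

(** If [x] and [y] differ at [i], the line through [x] in direction [i] has [q] points. A common
    neighbour off it shares coordinate [i] with [x], so it differs from [y] exactly there and is
    [upd y i (x i)]. *)
Lemma hamming_codeg x y : x != y -> codeg (hamming d q) x y <= q.+1.
Proof.
case/eqP/ffunP/eqfunP/forallPn=> i xyi.
suff sub : [set w | hamming d q x w && hamming d q y w]
    \subset upd y i (x i) |: [set upd x i a | a : 'I_q].
  apply: leq_trans (subset_leq_card sub) _.
  apply: leq_trans (leq_card_setU _ _) _.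
  by rewrite cards1 card_imset ?cardT ?size_enum_ord //; apply: upd_inj.
apply/subsetP=> w; rewrite !inE => /andP[/hammingP[j [xwj xw]] /hammingP[k [ywk yw]]].
have [->|] := eqVneq i j; first by rewrite xw imset_f ?orbT.
rewrite eq_sym => ij; have wi : w i = x i by rewrite xw updE eq_sym (negPf ij).
have [ik | ik] := eqVneq i k; first by rewrite yw -ik wi eqxx.
by move: xyi; rewrite -wi yw updE (negPf ik) eqxx.
Qed.
End Hamming.

(** * Cartesian products *)

Section Cartesian.
Variables (T1 T2 : finType) (e1 : rel T1) (e2 : rel T2).
Local Notation e := (cartesian e1 e2).

Lemma pair_perm_sub_autgraph :
  pair_perm @* setX (autgraph e1) (autgraph e2) \subset autgraph e.
Proof.
apply/subsetP=> _ /morphimP[[s t] _ /setXP[/autgraphP se /autgraphP te] ->].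
apply/autgraphP=> -[x y] [x' y']; rewrite !permE /pair_perm_fun /cartesian /=.
by rewrite !(inj_eq perm_inj) se te.
Qed.

Variable m : nat.
Hypotheses (irr1 : irreflexive e1) (irr2 : irreflexive e2).
Hypothesis codeg1 : forall x x', m < codeg e1 x x'.
Hypotheses (m_gt1 : 1 < m) (codeg2 : forall y y', y != y' -> codeg e2 y y' <= m).
Hypothesis con2 : forall y y', connect e2 y y'.

(** Makes lying in the same copy of [T1] an invariant of automorphisms. Inside a copy the common
    neighbours for [e1] survive; vertices with equal first coordinates have only those coming from
    [e2]. *)
Lemma codeg_cartesian u v : (m < codeg e u v) = (u.2 == v.2).
Proof.
case: u v => [x y] [x' y'] /=; have [<- | yy'] := eqVneq y y'.
  apply: leq_trans (codeg1 x x') _.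
  have inj_y : injective (pair^~ y : T1 -> T1 * T2) by move=> ? ? [].
  rewrite /codeg -(card_imset _ inj_y); apply/subset_leq_card/subsetP=> p.
  case/imsetP=> z; rewrite inE => /andP[xz x'z] ->.
  by rewrite inE /cartesian /= eqxx xz x'z !orbT.
apply/negbTE; rewrite -leqNgt; have [<- | xx'] := eqVneq x x'.
  apply: leq_trans (codeg2 yy').
  have inj_x : injective (pair x : T2 -> T1 * T2) by move=> ? ? [].
  rewrite /codeg -[leqRHS](card_imset _ inj_x).
  apply/subset_leq_card/subsetP=> -[z w]; rewrite inE /cartesian /=.
  case/andP=> /orP[/andP[/eqP<- yw] | /andP[xz /eqP<-]]
    /orP[/andP[/eqP xz' y'w] | /andP[xz' /eqP y'w]].
  - by rewrite imset_f // inE yw.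
  - by rewrite irr1 in xz'.
  - by rewrite xz' irr1 in xz.
  - by rewrite y'w eqxx in yy'.
(* When both coordinates differ, only the two other corners of the rectangle can be common
   neighbours, and [1 < m] reads [2 <= m]. *)
apply: leq_trans m_gt1; rewrite -[2](_ : #|[set (x, y'); (x', y)]| = 2).
  apply/subset_leq_card/subsetP=> -[z w]; rewrite !inE /cartesian /= !xpair_eqE.
  case/andP=> /orP[/andP[/eqP<- yw] | /andP[xz /eqP<-]]
    /orP[/andP[/eqP xz' y'w] | /andP[xz' /eqP y'w]].
  - by rewrite xz' eqxx in xx'.
  - by rewrite y'w !eqxx.
  - by rewrite xz' !eqxx orbT.
  - by rewrite y'w eqxx in yy'.
by rewrite cards2 xpair_eqE (negPf xx').
Qed.

Lemma autgraph_cartesian (x0 : T1) (y0 : T2) :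
  autgraph e = pair_perm @* setX (autgraph e1) (autgraph e2) :> {set _}.
Proof.
apply/eqP; rewrite eqEsubset pair_perm_sub_autgraph andbT.
apply/subsetP=> f Af; have /autgraphP fe := Af.
have f2 u v : ((f u).2 == (f v).2) = (u.2 == v.2).
  by rewrite -!codeg_cartesian codeg_aut.
pose s x := (f (x, y0)).1; pose t y := (f (x0, y)).2.
have ft x y : (f (x, y)).2 = t y by apply/eqP; rewrite f2.
(* The image of an edge joining two copies cannot lie inside one copy, since by [f2] that would give
   [y = y']. *)
have step x y y' : e2 y y' -> (f (x, y)).1 = (f (x, y')).1 /\ e2 (t y) (t y').
  move=> yy'; have: e (f (x, y)) (f (x, y')).
    by rewrite fe /cartesian /= eqxx yy'.
  rewrite /cartesian !ft; case/orP=> /andP[] => [/eqP //|].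
  move=> _; rewrite -(ft x) -(ft x y') f2 /= => /eqP y_y'.
  by rewrite y_y' irr2 in yy'.
(* Along an [e2]-path from [y0] to [y], [step] keeps the first coordinate of the image constant. *)
have fs x y : (f (x, y)).1 = s x.
  have /connectP[p p_path ->] := con2 y0 y; rewrite /s.
  elim: p (y0) p_path => //= z p IHp y1 /andP[/(step x)[-> _]].
  exact: IHp.
have fE x y : f (x, y) = (s x, t y).
  by rewrite -(fs x y) -(ft x y); case: (f _).
have s_inj : injective s.
  by move=> x x' ss;
    have [] : (x, y0) = (x', y0) by apply: (@perm_inj _ f); rewrite !fE ss.
have t_inj : injective t.
  by move=> y y' tt;
    have [] : (x0, y) = (x0, y') by apply: (@perm_inj _ f); rewrite !fE tt.
have -> : f = pair_perm (perm s_inj, perm t_inj).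
  by apply/permP=> -[x y]; rewrite fE permE /pair_perm_fun /= !permE.
rewrite mem_morphim ?in_setT // in_setX.
apply/andP; split; apply/autgraphP.
  move=> x x'; have := fe (x, y0) (x', y0).
  by rewrite !fE /cartesian /= !irr2 !andbF !eqxx !andbT !permE.
move=> y y'; have := fe (x0, y) (x0, y').
by rewrite !fE /cartesian /= !irr1 !eqxx !andTb !orbF !permE.
Qed.
End Cartesian.

(** * Regular subgroups of direct products *)

Section RegularPair.
Variables (T1 T2 : finType) (x0 : T1) (y0 : T2).
Local Notation perm2 := ({perm T1} * {perm T2})%type.

Lemma pair_permE (st : perm2) u : pair_perm st u = (st.1 u.1, st.2 u.2).
Proof. by rewrite permE. Qed.

Lemma mul_pair_perm a b c d :
  @pair_perm T1 T2 (a, c) * pair_perm (b, d) = pair_perm (a * b, c * d).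
Proof. by rewrite -pair_permM ?in_setT. Qed.

Lemma conj_pair_perm a b c d :
  @pair_perm T1 T2 (a, c) ^ pair_perm (b, d) = pair_perm (a ^ b, c ^ d).
Proof.
by apply: (mulgI (pair_perm (b, d))); rewrite -conjgC !mul_pair_perm -!conjgC.
Qed.

(** Each component is read off by freezing the other coordinate at [x0] or [y0]; with an empty
    factor it would be lost. *)
Lemma pair_perm_injective : injective (@pair_perm T1 T2).
Proof.
move=> [s t] [s' t'] /permP est; congr (_, _); apply/permP=> z.
  by have := est (z, y0); rewrite !pair_permE => -[].
by have := est (x0, z); rewrite !pair_permE => -[].
Qed.

Lemma injm_pair_perm : 'injm (@pair_perm T1 T2).
Proof. exact/injmP/(in2W pair_perm_injective). Qed.

Lemma mem_pair_perm (st : perm2) (B : {set perm2}) :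
  (pair_perm st \in pair_perm @* B) = (st \in B).
Proof.
apply/idP/idP=> [/morphimP[st' _ Bst'] | Bst]; last by rewrite mem_morphim ?in_setT.
by move/pair_perm_injective->.
Qed.

(** * The groups [R_phi]: quotient, regularity and semidirect structure *)

Section Quotient.
Variables (A : {group {perm T1}}) (G H : {group {perm T2}}).
Variable phi : {morphism A >-> coset_of H}.

Lemma mem_R_phi a c : (pair_perm (a, c) \in R_phi G phi) =
  [&& a \in A, c \in 'N_G(H) & coset H c == phi a].
Proof. by rewrite mem_pair_perm mem_R_pairs. Qed.

Lemma R_phiP r : r \in R_phi G phi ->
  exists a c, [/\ a \in A, c \in 'N_G(H), coset H c = phi a & r = pair_perm (a, c)].
Proof.
case/morphimP=> -[a c] _; rewrite mem_R_pairs => /and3P[Aa Nc /eqP ca] ->.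
by exists a, c.
Qed.

Hypothesis im_phi : phi @* A \subset 'N_G(H) / H.

Lemma R_phi_lift a : a \in A ->
  exists c, pair_perm (a, c) \in R_phi G phi.
Proof.
move=> Aa; have: phi a \in 'N_G(H) / H.
  by rewrite (subsetP im_phi) ?mem_morphim.
by case/morphimP=> c _ Nc ac; exists c; rewrite mem_R_phi Aa Nc ac eqxx.
Qed.

(** The projection to the first component maps onto [A] because every [phi a] has a representative
    in the normalizer; [L] is its kernel. *)
Lemma R_phi_quotient : exists2 L : {group {perm T1 * T2}},
  L <| R_phi G phi & R_phi G phi / L \isog A.
Proof.
pose f := [morphism of (@fst _ _ : perm2 -> {perm T1}) \o invm injm_pair_perm].
have sRf : R_phi G phi \subset 'dom f.
  by rewrite /= -sub_morphim_pre ?subsetT // morphimS // subsetT.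
exists ('ker_(R_phi G phi) f)%G; first exact: normalGI (ker_normal f).
suff <- : f @* R_phi G phi = A by apply: first_isog_loc.
have fE st : f (pair_perm st) = st.1 by rewrite /= invmE ?in_setT.
apply/setP=> a; apply/idP/idP=> [/morphimP[r _ /R_phiP[b [c [Ab _ _ ->]]] ->] | Aa].
  by rewrite fE.
have [c Rac] := R_phi_lift Aa.
by rewrite -[a]/((a, c).1) -fE mem_morphim // (subsetP sRf).
Qed.

Hypotheses (sHG : H \subset G) (regH : regular_perm_group H).

(** For transitivity, lift [a] to some [c] and correct [c] by an element of [H], which keeps its
    coset. For freeness, [a] fixing a point is [1], so [c] lies in [H] and fixes a point. *)
Lemma R_phi_regular : regular_perm_group A -> regular_perm_group (R_phi G phi).
Proof.
case/(regular_permP x0)=> trA stA; have [trH stH] := elimT (regular_permP y0 H) regH.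
apply/(regular_permP (x0, y0)); split=> [[x y] [x' y'] | r [x y]].
  have [a Aa ax] := trA x x'; have [c Rac] := R_phi_lift Aa.
  have [h Hh hy] := trH (c y) y'.
  exists (pair_perm (a, c * h)); last by rewrite pair_permE /= ax permM hy.
  move: Rac; rewrite !mem_R_phi => /and3P[-> Nc /eqP<-] /=.
  have Nh : h \in 'N_G(H) by rewrite inE (subsetP sHG) // (subsetP (normG H)).
  have [_ nHc] := setIP Nc.
  by rewrite groupM //= coset_kerr.
case/R_phiP=> a [c [Aa Nc ca ->]]; rewrite pair_permE => -[/= ax cy].
have a1 := stA _ _ Aa ax; rewrite a1 in ca *.
have [_ nHc] := setIP Nc.
have Hc : c \in H by apply: coset_idr => //; rewrite ca morph1.
by rewrite (stH _ _ Hc cy) morph1.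
Qed.

Variable w : T2.
Local Notation lift a := (stab_lift sHG regH w (phi a)).

Lemma stab_liftP a : a \in A ->
  lift a \in 'C_('N_G(H))[w | 'P] /\ coset H (lift a) = phi a.
Proof.
move=> Aa; have: phi a \in stab_coset G H w @* 'C_('N_G(H))[w | 'P].
  by rewrite im_stab_coset // (subsetP im_phi) ?mem_morphim.
by case/morphimP=> c Nc _ ->; rewrite /stab_lift invmE.
Qed.

(** The pairs [(1, h)] form a normal copy of [H], and the pairs [(a, lift a)] a complement
    isomorphic to [A], with [lift a] the representative of [phi a] fixing [w]. Conjugation by
    [(a, lift a)] sends [(1, h)] to [(1, h ^ lift a)], which is the action [psi]. *)
Lemma R_phi_isog_sdprod :
  R_phi G phi \isog [set: H_sdprod_A sHG regH im_phi w].
Proof.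
pose fH h : {perm T1 * T2} := pair_perm (1, h).
pose fA a : {perm T1 * T2} := pair_perm (a, lift a).
have fHM : {in H &, {morph fH : h k / h * k}}.
  by move=> h k _ _; rewrite /fH mul_pair_perm mulg1.
have fAM : {in A &, {morph fA : a b / a * b}}.
  move=> a b Aa Ab; rewrite /fA mul_pair_perm; congr (pair_perm (_, _)).
  by rewrite /stab_lift !morphM ?im_stab_coset // (subsetP im_phi) ?mem_morphim.
have actf : {in H & A, morph_act (aut_act (conj_psi_Aut sHG regH im_phi w)) 'J
    (Morphism fHM) (Morphism fAM)}.
  move=> h a Hh Aa; rewrite aut_actE //; have [Nl ca] := stab_liftP Aa.
  have -> : conj_psi phi sHG regH w a h = h ^ lift a.
    by rewrite /conj_psi; move: (lift a) Nl ca => n Nn <-; apply: norm_embed_coset.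
  by rewrite /= /fH /fA conj_pair_perm conj1g.
rewrite isog_sym; apply/isogP; exists (xsdprod_morphism actf).
  rewrite injm_xsdprodm; apply/and3P; split.
  - by apply/injmP=> h k _ _ /pair_perm_injective[].
  - by apply/injmP=> a b _ _ /pair_perm_injective[].
  apply/eqP/trivgP/subsetP=> _ /setIP[/morphimP[h _ Hh ->]].
  case/morphimP=> a _ Aa /= /pair_perm_injective[<- ->].
  have -> : lift 1 = 1 by rewrite morph1 /stab_lift morph1.
  by apply/set1gP; apply: (morph1 (@pair_perm_morphism T1 T2)).
rewrite im_xsdprodm; apply/setP=> r; apply/mulsgP/idP.
  case=> _ _ /morphimP[h _ Hh ->] /morphimP[a _ Aa ->] ->.
  have [/setIP[Nl _] ca] := stab_liftP Aa; have [_ nl] := setIP Nl.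
  have Nh : h \in 'N_G(H) by rewrite inE (subsetP sHG) // (subsetP (normG H)).
  by rewrite mul_pair_perm mul1g mem_R_phi Aa groupM //= coset_kerl // ca.
case/R_phiP=> a [c [Aa Nc ca ->]]; have [/setIP[Nl _] cl] := stab_liftP Aa.
have [[_ nl] [_ nc]] := (setIP Nl, setIP Nc).
(* Both [c] and [lift a] represent [phi a]. *)
have Hcl : c * (lift a)^-1 \in H.
  by rewrite -mem_rcoset; apply/rcoset_kercosetP; rewrite // ca cl.
exists (fH (c * (lift a)^-1)) (fA a).
- exact: (mem_morphim (Morphism fHM)).
- exact: (mem_morphim (Morphism fAM)).
by rewrite mul_pair_perm mul1g mulgKV.
Qed.
End Quotient.

(** * Every regular subgroup of the product is some [R_phi] *)

Section Classification.
Variables (A : {group {perm T1}}) (G : {group {perm T2}}).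
Hypothesis regA : regular_perm_group A.

Theorem regular_subgroups_pair (R : {group {perm T1 * T2}}) :
  (R \subset pair_perm @* setX A G /\ regular_perm_group R) <->
  (exists (H : {group {perm T2}}) (phi : {morphism A >-> coset_of H}),
     [/\ H \subset G, regular_perm_group H, phi @* A \subset 'N_G(H) / H
       & R :=: R_phi G phi]).
Proof.
split=> [[sRX regR] | [H [phi [sHG regH im_phi defR]]]]; last first.
  have -> : R = R_phi G phi by apply: val_inj.
  split; last exact: R_phi_regular.
  apply/subsetP=> _ /R_phiP[a [c [Aa /setIP[Gc _] _ ->]]].
  by rewrite mem_pair_perm in_setX Aa.
have [trA stA] := elimT (regular_permP x0 _) regA.
have [trR stR] := elimT (regular_permP (x0, y0) _) regR.
have RAG a c : pair_perm (a, c) \in R -> a \in A /\ c \in G.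
  by move/(subsetP sRX); rewrite mem_pair_perm in_setX => /andP.
have A_eq a b x : a \in A -> b \in A -> a x = b x -> a = b.
  move=> Aa Ab ab; apply/eqP; rewrite eq_mulgV1; apply/eqP.
  by apply: (stA _ x); rewrite ?groupM ?groupV // permM ab permK.
(* An element of [R] sending [(x0, y)] to [(a x0, y')] has a first component agreeing with [a] at
   [x0], hence equal to [a] by regularity of [A]. *)
have lift_R a y y' : a \in A -> exists2 c, pair_perm (a, c) \in R & c y = y'.
  move=> Aa; have [r Rr] := trR (x0, y) (a x0, y').
  have /morphimP[[b c] _ _ def_r] := subsetP sRX r Rr.
  rewrite def_r in Rr *; rewrite pair_permE => -[/= ba cy].
  have [Ab _] := RAG _ _ Rr; exists c => //.
  by rewrite -(A_eq _ _ _ Ab Aa ba).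
have [H HE] : exists H : {group {perm T2}},
    forall c, (c \in H) = (pair_perm (1, c) \in R).
  by exists ((@pair_perm T1 T2 \o @pair1g _ _) @*^-1 R)%G => c; rewrite !inE.
have sHG : H \subset G by apply/subsetP=> c; rewrite HE => /RAG[].
have regH : regular_perm_group H.
  apply/(regular_permP y0); split=> [y y' | c y].
    by have [c Rc cy] := lift_R 1 y y' (group1 _); exists c; rewrite ?HE.
  rewrite HE => Rc cy; have: pair_perm (1, c) = 1 :> {perm T1 * T2}.
    by apply: (stR _ (x0, y)) => //; rewrite pair_permE /= perm1 cy.
  by rewrite -(morph1 (@pair_perm T1 T2)) => /pair_perm_injective[].
have nHR a c : pair_perm (a, c) \in R -> c \in 'N(H).
  move=> Rac; rewrite inE; apply/subsetP=> _ /imsetP[h Hh ->]; move: Hh.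
  by rewrite !HE -{2}(conj1g a) -conj_pair_perm => Rh; rewrite groupJ.
(* The quotient of [(a, c)] by [(a, c')] is [(1, c * c'^-1)], so [c * c'^-1] lies in [H]. *)
have coset_eq a c c' : pair_perm (a, c) \in R -> pair_perm (a, c') \in R ->
    coset H c = coset H c'.
  move=> Rc Rc'; apply/rcoset_kercosetP; rewrite ?(nHR a) //.
  rewrite mem_rcoset HE -(mulgV a) -mul_pair_perm groupMl //.
  have -> : pair_perm (a^-1, c'^-1) = (pair_perm (a, c'))^-1.
    by apply: (mulgI (pair_perm (a, c'))); rewrite mul_pair_perm !mulgV morph1.
  by rewrite groupV.
(* An arbitrary choice of second component over [a]; the default [1] occurs only outside [A].
   Multiplicativity is obtained for its coset modulo [H]. *)
pose chi a := odflt 1 [pick c | pair_perm (a, c) \in R].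
have chiP a : a \in A -> pair_perm (a, chi a) \in R.
  move=> Aa; rewrite /chi; case: pickP => //= noc.
  by have [c Rc _] := lift_R a y0 y0 Aa; rewrite noc in Rc.
have phiM : {in A &, {morph (fun a => coset H (chi a)) : a b / a * b}}.
  move=> a b Aa Ab; have [Ra Rb] := (chiP a Aa, chiP b Ab).
  rewrite -coset_morphM ?(nHR _ _ Ra) ?(nHR _ _ Rb) //; apply: (coset_eq (a * b)).
    by rewrite chiP ?groupM.
  by rewrite -mul_pair_perm groupM.
have Nchi a : a \in A -> chi a \in 'N_G(H).
  by move=> Aa; rewrite inE (nHR a) ?chiP //; have [_ ->] := RAG _ _ (chiP a Aa).
exists H, (Morphism phiM); split=> //.
  apply/subsetP=> _ /morphimP[a _ Aa ->] /=.
  by rewrite mem_quotient ?Nchi.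
apply/setP=> r; apply/idP/idP=> [Rr | /R_phiP[a [c [Aa /setIP[_ nc] /= ca ->]]]].
  have /morphimP[[a c] _ _ def_r] := subsetP sRX r Rr.
  rewrite def_r in Rr *; have [Aa Gc] := RAG _ _ Rr.
  rewrite mem_R_phi Aa inE Gc (nHR a) //=.
  by apply/eqP/(coset_eq a); last apply: chiP.
have [_ nchi] := setIP (Nchi a Aa).
have: c \in H :* chi a by apply/rcoset_kercosetP.
by rewrite mem_rcoset HE -(groupMr _ (chiP a Aa)) mul_pair_perm mul1g mulgKV.
Qed.
End Classification.
End RegularPair.

(** * Cayley graphs as regular subgroups, and the result for [Gamma d] *)

(** The right translations of [K], transported to [T] along the graph isomorphism, form [R]. *)
Lemma Cayley_regular (K : finGroupType) (T : finType) (e : rel T) :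
  is_Cayley_graph_of K e -> exists R : {group {perm T}},
    [/\ R \subset autgraph e, regular_perm_group R & [set: K] \isog R].
Proof.
case=> S [_ _ [f [g fK gK] fe]].
have tr_inj k : injective (fun x => g (f x * k)).
  by move=> x y /(can_inj gK)/mulIg/(can_inj fK).
pose tr k := perm (@tr_inj k).
have trE k x : tr k x = g (f x * k) by rewrite permE.
have trM : {in [set: K] &, {morph tr : k l / k * l}}.
  by move=> k l _ _; apply/permP=> x; rewrite permM !trE gK mulgA.
pose t := Morphism trM; exists (t @* [set: K])%G; split.
- apply/subsetP=> _ /morphimP[k _ _ ->]; apply/autgraphP=> x y.
  by rewrite -!fe /= !trE !gK /Cay invMg mulgA mulgK.
- apply/(regular_permP (g 1)); split=> [x y | _ x /morphimP[k _ _ ->]].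
    exists (tr ((f x)^-1 * f y)); last by rewrite trE mulKVg fK.
    by apply: (mem_morphim t); rewrite in_setT.
  rewrite /= trE => /(canRL gK)/(canRL (mulKg _)); rewrite mulVg => ->.
  exact: (morph1 t).
apply/isogP; exists t => //; apply/injmP=> k l _ _ /= /permP/(_ (g 1)).
by rewrite !trE gK !mul1g => /(can_inj gK).
Qed.

Lemma F20_not_abelian : ~~ abelian [set: F20].
Proof.
apply/negP=> /centsP/(_ F20_a (in_setT _) F20_b (in_setT _))/eqP.
by vm_compute.
Qed.

Theorem theorem7p2 (d : nat) :
  [/\ autgraph X14 \isog [set: F20],
      autgraph (Gamma d) =
        pair_perm @* setX (autgraph X14) (W d) :> {set _},
      forall R : {group {perm F20 * {ffun 'I_d -> 'I_6}}},
        (R \subset autgraph (Gamma d) /\ regular_perm_group R) <->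
        (exists (H : {group {perm {ffun 'I_d -> 'I_6}}})
                (phi : {morphism autgraph X14 >-> coset_of H}),
          [/\ H \subset W d, regular_perm_group H,
              phi @* autgraph X14 \subset 'N_(W d)(H) / H
            & R :=: R_phi (W d) phi]),
      forall (H : {group {perm {ffun 'I_d -> 'I_6}}})
             (phi : {morphism autgraph X14 >-> coset_of H})
             (sHW : H \subset W d) (regH : regular_perm_group H)
             (im_phi : phi @* autgraph X14 \subset 'N_(W d)(H) / H),
        (forall w : {ffun 'I_d -> 'I_6},
           R_phi (W d) phi \isog
             [set: H_sdprod_A sHW regH im_phi w]) /\
        (exists2 L : {group {perm F20 * {ffun 'I_d -> 'I_6}}},
           L <| R_phi (W d) phi & R_phi (W d) phi / L \isog [set: F20])
    & forall K : finGroupType,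
        abelian [set: K] -> ~ is_Cayley_graph_of K (Gamma d)].
Proof.
have A_F20 : autgraph X14 \isog [set: F20].
  by rewrite autgraph_X14 isog_sym right_translations_isog.
have regA : regular_perm_group (autgraph X14).
  by rewrite autgraph_X14 right_translations_regular.
have y0 : {ffun 'I_d -> 'I_6} := [ffun=> ord0].
have autG : autgraph (Gamma d) = pair_perm @* setX (autgraph X14) (W d) :> {set _}.
  rewrite [RHS](_ : _ = pair_perm @* setX (autgraph X14) (autgraph (hamming d 6))).
    (* The value 7 lies below every [codeg] of X14 and is the upper bound [q.+1] for distinct
       vertices of the Hamming graph. *)
    apply: (autgraph_cartesian (m := 7)) => //.
    - by move=> g; rewrite /X14 /Cay mulgV (negPf S14_not1).
    - exact: hamming_irrefl.
    - exact: X14_codeg.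
    - exact: hamming_codeg.
    - exact: hamming_connect.
    - exact: 1.
  by rewrite autgraph_hamming.
have regR (R : {group {perm F20 * {ffun 'I_d -> 'I_6}}}) :
    (R \subset autgraph (Gamma d) /\ regular_perm_group R) <->
    (exists (H : {group {perm {ffun 'I_d -> 'I_6}}})
            (phi : {morphism autgraph X14 >-> coset_of H}),
      [/\ H \subset W d, regular_perm_group H,
          phi @* autgraph X14 \subset 'N_(W d)(H) / H
        & R :=: R_phi (W d) phi]).
  by rewrite autG; apply: (regular_subgroups_pair (1 : F20) y0).
have quoR (H : {group {perm {ffun 'I_d -> 'I_6}}})
    (phi : {morphism autgraph X14 >-> coset_of H}) :
    phi @* autgraph X14 \subset 'N_(W d)(H) / H ->
  exists2 L : {group {perm F20 * {ffun 'I_d -> 'I_6}}},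
    L <| R_phi (W d) phi & R_phi (W d) phi / L \isog [set: F20].
  move=> im_phi; have [L nL quoL] := R_phi_quotient (1 : F20) y0 im_phi.
  by exists L => //; apply: isog_trans quoL A_F20.
split=> // [H phi sHW regH im_phi | K abK /Cayley_regular[R [sR rR isoR]]].
  by split; [move=> w; apply: (R_phi_isog_sdprod (1 : F20) y0) | apply: quoR].
(* [R] is isomorphic to the abelian group [K], yet it has a quotient isomorphic to the nonabelian
   [F20]. *)
have [H [phi [_ _ im_phi defR]]] := (regR R).1 (conj sR rR).
have [L _ quoL] := quoR H phi im_phi.
have /negP[] := F20_not_abelian.
by rewrite -(isog_abelian quoL) quotient_abelian // -defR -(isog_abelian isoR).
Qed.
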